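(* Let $X$ be a compact metrizable space and let $\Delta$ be a closed set of Borel probability measures on $X$. Then $(X,\Delta)$ has the small boundary property (SBP) if, and only if, for every continuous function $f\colon X\to\mathbb R$ and every $\varepsilon>0$ there is a continuous function $g\colon X\to\mathbb R$ such that (1) $\|f-g\|_{2,\Delta}<\varepsilon$, and (2) $\mu(g^{-1}(0))<\varepsilon$ for all $\mu\in\Delta$. Moreover, for a continuous $g\colon X\to\mathbb R$, condition (2) is equivalent to the existence of $\delta>0$ such that $\tau_\mu(\chi_\delta(g))<\varepsilon$ for all $\mu\in\Delta$, where $\chi_\delta\colon\mathbb R\to\mathbb R$ is the continuous function equal to $1$ on $\{|t|<\delta/2\}$, equal to $0$ on $\{|t|>\delta\}$, and linear in between.
   Context: ''Closed'' refers to the weak* topology on Borel probability measures. For a Borel probability measure $\mu$, $\tau_\mu(h)=\int h\,d\mu$ for $h\in \mathrm{C}(X)$. For $f\in \mathrm{C}(X)$, $\|f\|_{2,\Delta}=\sup\{(\int|f|^2d\mu)^{1/2}:\mu\in\Delta\}$. The pair $(X,\Delta)$ has the small boundary property (SBP) if for every $x\in X$ and every open set $U\ni x$ there is an open neighbourhood $V\subseteq U$ of $x$ with $\mu(\partial V)=0$ for all $\mu\in\Delta$ (equivalently: for all closed $V\subseteq$ open $U$ there is a closed $V'$ with $V\subseteq V'\subseteq U$ and $\mu(\partial V')=0$ for all $\mu\in\Delta$). *)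

(* Defs.v *)
From HB Require Import structures.
From mathcomp Require Import all_boot all_order all_algebra.
From mathcomp Require Import all_classical all_reals all_analysis.
Set Implicit Arguments. Unset Strict Implicit. Unset Printing Implicit Defensive.
Import Order.TTheory GRing.Theory Num.Theory.
Import numFieldNormedType.Exports.
Local Open Scope classical_set_scope.
Local Open Scope ring_scope.

Definition borel (X : ptopologicalType) := g_sigma_algebraType (@open X).

Definition BorelProb (R : realType) (X : ptopologicalType) :=
  probability (borel X) R.

Definition tau (R : realType) (X : ptopologicalType) (mu : BorelProb R X)
  (h : X -> R) : R := Rintegral mu setT (h : borel X -> R).

(* Delta is closed in the weak* topology on Borel probability measures:
   every mu all of whose weak* basic neighbourhoods
   {nu | |tau nu (h_i) - tau mu (h_i)| < e, i < n} (h_i continuous) meet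
   Delta belongs to Delta. *)
Definition weak_star_closed (R : realType) (X : ptopologicalType)
  (Delta : set (BorelProb R X)) : Prop :=
  forall mu : BorelProb R X,
    (forall (n : nat) (h : 'I_n -> X -> R), (forall i, continuous (h i)) ->
       forall e : R, 0 < e ->
       exists nu, Delta nu /\ forall i, `|tau nu (h i) - tau mu (h i)| < e) ->
    Delta mu.

Definition norm2Delta (R : realType) (X : ptopologicalType)
  (Delta : set (BorelProb R X)) (f : X -> R) : \bar R :=
  ereal_sup [set (Num.sqrt (tau mu (fun x => `|f x| ^+ 2)))%:E | mu in Delta].

Definition boundary (X : topologicalType) (A : set X) : set X :=
  closure A `\` interior A.

Definition SBP (R : realType) (X : ptopologicalType)
  (Delta : set (BorelProb R X)) : Prop :=
  forall (x : X) (U : set X), open U -> U x ->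
    exists V : set X, [/\ open V, V x, V `<=` U &
      forall mu, Delta mu -> mu (boundary V : set (borel X)) = 0%E].

Definition chi (R : realType) (delta : R) (t : R) : R :=
  if `|t| < delta / 2 then 1
  else if delta < `|t| then 0
  else 2 * (delta - `|t|) / delta.

(* Main.v *)
(* From the small boundary property: enclose {f >= 0} in an open V inside
   {f > -eta} with null boundary, let s be a continuous function that is positive on V
   and negative off its closure; then max (f, min (f + 2 eta, s)) is uniformly
   within 2 eta of f and vanishes only on the boundary of V.

   Conversely, truncating a 2-norm approximation of f to [f - eta, f + eta]
   makes the approximation uniform, by Chebyshev's inequality.  Having uniformly
   small zero sets is an open condition for the uniform norm, so a Baire type
   iteration gives g uniformly close to f with null zero set; if f separates x
   from the complement of U, then {g > 0} is the required neighbourhood.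

   The openness is the last assertion of the theorem.  If it fails, pick mu_n in
   Delta with tau_{mu_n} (chi_{1/n} o g) >= eps; an ultrafilter limit of the
   tau_{mu_n} is a positive functional on C(X), by the Riesz representation
   theorem it is tau_mu for some mu in Delta, and mu (g = 0) >= eps. *)

Require Import Defs.
From HB Require Import structures.
From mathcomp Require Import all_boot all_order all_algebra.
From mathcomp Require Import all_classical all_reals all_analysis.
From mathcomp Require Import measurable_realfun finmap lra ring.
Import Order.TTheory GRing.Theory Num.Theory.
Import numFieldNormedType.Exports.
Local Open Scope classical_set_scope.
Local Open Scope ring_scope.
Set Implicit Arguments.
Unset Strict Implicit.
Unset Printing Implicit Defensive.

(** * Continuous functions *)

Section continuous_operations.
Context {R : realType} {T : topologicalType}.
Implicit Types f g : T -> R.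

Lemma continuous_fun_cst (a : R) : continuous (fun _ : T => a).
Proof. by move=> x; exact: cvg_cst. Qed.

Lemma continuous_fun_add f g : continuous f -> continuous g ->
  continuous (fun x => f x + g x).
Proof. by move=> cf cg x; apply: cvgD; [exact: cf|exact: cg]. Qed.

Lemma continuous_fun_sub f g : continuous f -> continuous g ->
  continuous (fun x => f x - g x).
Proof. by move=> cf cg x; apply: cvgB; [exact: cf|exact: cg]. Qed.

Lemma continuous_fun_mul f g : continuous f -> continuous g ->
  continuous (fun x => f x * g x).
Proof. by move=> cf cg x; apply: cvgM; [exact: cf|exact: cg]. Qed.

Lemma continuous_fun_norm f : continuous f -> continuous (fun x => `|f x|).
Proof. by move=> cf x; apply: cvg_norm; exact: cf. Qed.

Lemma continuous_fun_min f g : continuous f -> continuous g ->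
  continuous (fun x => Num.min (f x) (g x)).
Proof. by move=> cf cg; exact: min_fun_continuous. Qed.

Lemma continuous_fun_max f g : continuous f -> continuous g ->
  continuous (fun x => Num.max (f x) (g x)).
Proof. by move=> cf cg; exact: max_fun_continuous. Qed.

Lemma continuous_fun_sum (n : nat) (F : nat -> T -> R) :
  (forall i, continuous (F i)) -> continuous (fun x => \sum_(i < n) F i x).
Proof.
move=> cF; elim: n => [|n IH].
  by under eq_fun do rewrite big_ord0; exact: continuous_fun_cst.
by under eq_fun do rewrite big_ord_recr/=; exact: continuous_fun_add.
Qed.

Lemma open_gt_fun f (a : R) : continuous f -> open [set x | a < f x].
Proof.
move=> cf; rewrite (_ : [set _ | _] = f @^-1` [set y | a < y]) //.
by apply: open_comp; [move=> x _; exact: cf|exact: open_gt].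
Qed.

Lemma open_lt_fun f (a : R) : continuous f -> open [set x | f x < a].
Proof.
move=> cf; rewrite (_ : [set _ | _] = f @^-1` [set y | y < a]) //.
by apply: open_comp; [move=> x _; exact: cf|exact: open_lt].
Qed.

Lemma closed_ge_fun f (a : R) : continuous f -> closed [set x | a <= f x].
Proof.
move=> cf; rewrite (_ : [set _ | _] = f @^-1` [set y | a <= y]) //.
by apply: closed_comp; [move=> x _; exact: cf|exact: closed_ge].
Qed.

Lemma closed_le_fun f (a : R) : continuous f -> closed [set x | f x <= a].
Proof.
move=> cf; rewrite (_ : [set _ | _] = f @^-1` [set y | y <= a]) //.
by apply: closed_comp; [move=> x _; exact: cf|exact: closed_le].
Qed.

Lemma closed_zero_set g : continuous g -> closed (g @^-1` [set 0]).
Proof.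
move=> cg; rewrite (_ : _ @^-1` _ = [set x | `|g x| <= 0]).
  by apply: closed_le_fun; exact: continuous_fun_norm.
by apply/seteqP; split => x /=; [move=> ->; rewrite normr0|rewrite normr_le0 => /eqP].
Qed.

End continuous_operations.

Section continuous_functions.
Context {R : realType} {X : pseudoPMetricType R}.
Implicit Types (f g h : X -> R) (U V : set X).

Lemma continuous_bounded f : compact [set: X] -> continuous f ->
  exists2 M : R, 0 < M & forall x, `|f x| <= M.
Proof.
move=> cX cf.
have : compact (f @` [set: X]).
  by apply: continuous_compact => //; apply: continuous_subspaceT.
move=> /compact_bounded[M [_ MP]]; exists (`|M| + 1).
  by rewrite ltr_wpDl.
move=> x; apply: MP; last by exists x.
by rewrite (le_lt_trans (ler_norm M))// ltrDl.
Qed.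

(** The distance to the complement of [U] works, except that it is extended-real valued: it is [+oo]
    when the complement is empty. Composing with [contract] makes it real and preserves its sign. *)
Lemma exists_cutoff U : open U -> exists p : X -> R,
  [/\ continuous p, forall x, 0 <= p x, forall x, U x -> 0 < p x &
      forall x, ~ U x -> p x = 0].
Proof.
move=> oU; pose d := @edist_inf R X (~` U).
have cd : continuous d by exact: edist_inf_continuous.
exists (fun x => contract (d x)); split.
- move=> x; apply/cvgrPdist_lt => e e0.
  have /cd : nbhs (d x) (ball (d x) e) by exact: nbhsx_ballx.
  by [].
- by move=> x; rewrite -(contract0 R) le_contract edist_inf_ge0.
- move=> x Ux; rewrite -(contract0 R) lt_contract lt_neqAle edist_inf_ge0 andbT.
  apply/eqP => d0; have /nbhs_ballP[e /= e0 xeU] := open_nbhs_nbhs (conj oU Ux).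
  have : (d x < e%:E)%E by rewrite -d0 lte_fin.
  move=> /ereal_inf_lt[_ [y yU <-]] /edist_lt_ball xy.
  exact/yU/xeU.
- by move=> x Ux; rewrite /d edist_inf0// contract0.
Qed.

(** The difference of the cutoffs of [V] and of the complement of [closure V]; these two open sets
    are disjoint, so the signs do not interfere. *)
Lemma exists_sign_function V : open V -> exists s : X -> R,
  [/\ continuous s, forall x, V x -> 0 < s x &
      forall x, ~ closure V x -> s x < 0].
Proof.
move=> oV; have [p [cp p0 pV pV0]] := exists_cutoff oV.
have oW : open (~` closure V) by rewrite openC; exact: closed_closure.
have [q [cq q0 qW qW0]] := exists_cutoff oW.
exists (fun x => p x - q x); split.
- by move=> x; apply: cvgB; [exact: cp|exact: cq].
- by move=> x Vx; rewrite qW0 ?subr0 ?pV// => /(_ (subset_closure Vx)).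
- move=> x Vx; rewrite pV0 ?sub0r ?oppr_lt0; last by move=> /subset_closure.
  exact: qW.
Qed.

End continuous_functions.

(** * The functions [chi d] *)

(** As a clamped expression, [chi] inherits continuity and monotonicity in [d] from [min], [max] and
    [1 - |t| / d]. *)
Lemma chiE (R : realType) (d t : R) : 0 < d ->
  chi d t = Num.min 1 (Num.max 0 (2 * (d - `|t|) / d)).
Proof.
move=> d0; rewrite /chi.
have -> : 2 * (d - `|t|) / d = 2 - 2 * `|t| / d by field; rewrite gt_eqF.
case: ltP => [td|td].
  rewrite min_l// le_max; apply/orP; right.
  suff : 2 * `|t| / d <= 1 by lra.
  by rewrite ler_pdivrMr//; lra.
have h1 : 1 <= 2 * `|t| / d.
  by rewrite ler_pdivlMr//; lra.
case: ltP => [dt|dt].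
  rewrite max_l ?min_r//.
  suff : 2 <= 2 * `|t| / d by lra.
  by rewrite ler_pdivlMr// ler_pM2l// ltW.
have h2 : 2 * `|t| / d <= 2 by rewrite ler_pdivrMr// ler_pM2l.
by rewrite max_r ?min_r//; lra.
Qed.

Lemma chi_continuous (R : realType) (d : R) : 0 < d -> continuous (chi d).
Proof.
move=> d0; rewrite (_ : chi d =
  (fun t => Num.min 1 (Num.max 0 (2 * (d - `|t|) / d)))); last first.
  by apply/funext => t; rewrite chiE.
apply/continuous_fun_min; first exact: continuous_fun_cst.
apply/continuous_fun_max; first exact: continuous_fun_cst.
apply: continuous_fun_mul; last exact: continuous_fun_cst.
apply: continuous_fun_mul; first exact: continuous_fun_cst.
apply: continuous_fun_sub; first exact: continuous_fun_cst.
exact: norm_continuous.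
Qed.

Lemma chi_ge0 (R : realType) (d t : R) : 0 < d -> 0 <= chi d t.
Proof. by move=> d0; rewrite chiE// le_min ler01 le_max lexx. Qed.

Lemma chi_le1 (R : realType) (d t : R) : 0 < d -> chi d t <= 1.
Proof. by move=> d0; rewrite chiE// ge_min lexx. Qed.

Lemma chi_eq0 (R : realType) (d t : R) : 0 < d -> d < `|t| -> chi d t = 0.
Proof.
move=> d0 dt; rewrite /chi dt ifF//.
by apply/negbTE; rewrite -leNgt (le_trans _ (ltW dt))// ler_pdivrMr// ler_pMr//; lra.
Qed.

Lemma chi_eq1 (R : realType) (d t : R) : `|t| < d / 2 -> chi d t = 1.
Proof. by rewrite /chi => ->. Qed.

Lemma le_chi (R : realType) (d1 d2 t : R) : 0 < d1 -> d1 <= d2 ->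
  chi d1 t <= chi d2 t.
Proof.
move=> d10 d12; have d20 : 0 < d2 by exact: lt_le_trans d12.
rewrite !chiE// le_min ge_min lexx/= ge_min; apply/orP; right.
rewrite ge_max le_max lexx/= le_max; apply/orP; right.
rewrite -!mulrA ler_pM2l// !mulrBl !divff ?gt_eqF// lerB//.
by rewrite ler_wpM2l// lef_pV2.
Qed.

(** * Positive functionals and Borel probabilities *)

(** A state on C(X), encoded on all real functions with laws required only for continuous ones, so
    that [tau mu] and limits of such functionals fit directly. *)
Record positive_functional (R : realType) (X : topologicalType)
    (L : (X -> R) -> R) : Prop := PositiveFunctional {
  pf_add : forall f g : X -> R, continuous f -> continuous g ->
    L (fun x => f x + g x) = L f + L g ;
  pf_scale : forall (a : R) (f : X -> R), continuous f ->
    L (fun x => a * f x) = a * L f ;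
  pf_ge0 : forall f : X -> R, continuous f -> (forall x, 0 <= f x) -> 0 <= L f ;
  pf_one : L (fun=> 1) = 1 }.

Section positive_functional_theory.
Context {R : realType} {X : topologicalType} {L : (X -> R) -> R}.
Hypothesis pL : positive_functional L.
Implicit Types f g : X -> R.

Lemma pf_sub f g : continuous f -> continuous g ->
  L (fun x => f x - g x) = L f - L g.
Proof.
move=> cf cg; rewrite -[in RHS]mulN1r -pf_scale// -pf_add//.
  by congr L; apply/funext => x; rewrite mulN1r.
by apply: continuous_fun_mul => //; exact: continuous_fun_cst.
Qed.

Lemma pf_le f g : continuous f -> continuous g -> (forall x, f x <= g x) ->
  L f <= L g.
Proof.
move=> cf cg fg; rewrite -subr_ge0 -pf_sub//; apply: (pf_ge0 pL).
  exact: continuous_fun_sub.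
by move=> x; rewrite subr_ge0.
Qed.

Lemma pf_cst (a : R) : L (fun=> a) = a.
Proof.
rewrite -[RHS]mulr1 -(pf_one pL) -pf_scale//; last exact: continuous_fun_cst.
by congr L; apply/funext => x; rewrite mulr1.
Qed.

Lemma pf_le_cst f (a : R) : continuous f -> (forall x, f x <= a) -> L f <= a.
Proof.
by move=> cf fa; rewrite -[leRHS]pf_cst pf_le//; exact: continuous_fun_cst.
Qed.

Lemma pf_ge_cst f (a : R) : continuous f -> (forall x, a <= f x) -> a <= L f.
Proof.
by move=> cf fa; rewrite -[leLHS]pf_cst pf_le//; exact: continuous_fun_cst.
Qed.

End positive_functional_theory.

Lemma open_borel (X : ptopologicalType) (A : set X) : open A -> measurable (A : set (borel X)).
Proof. by move=> oA; exact: sub_sigma_algebra. Qed.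

Lemma closed_borel (X : ptopologicalType) (A : set X) : closed A -> measurable (A : set (borel X)).
Proof.
move=> cA; rewrite -[A]setCK; apply: measurableC.
by apply: open_borel; rewrite openC.
Qed.

Section borel_probability.
Context {R : realType} {X : pseudoPMetricType R}.
Hypothesis cX : compact [set: X].
Implicit Types (mu : BorelProb R X) (f g : X -> R) (A : set X).

Lemma continuous_borel f : continuous f ->
  measurable_fun setT (f : borel X -> R).
Proof.
move=> cf; apply: (measurability _ (RGenOpens.measurableE R)).
move=> _ [_ [a [b ->] <-]]; rewrite setTI; apply: open_borel.
by apply: open_comp; [move=> x _; exact: cf|exact: interval_open].
Qed.

Lemma continuous_integrable mu f : continuous f ->
  mu.-integrable setT (EFin \o (f : borel X -> R)).
Proof.
move=> cf; apply: measurable_bounded_integrable => //.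
- exact: (le_lt_trans (probability_le1 mu measurableT) (ltry 1)).
- exact: continuous_borel.
- have [M M0 fM] := continuous_bounded cX cf.
  exists M; split; first exact: num_real.
  by move=> r Mr x _; apply: (le_trans (fM x)); exact: ltW.
Qed.

Lemma tauE mu f : continuous f ->
  (\int[mu]_x ((f : borel X -> R) x)%:E = (tau mu f)%:E)%E.
Proof.
move=> cf; rewrite /tau /Rintegral fineK//.
exact: (integrable_fin_num _ (continuous_integrable mu cf)).
Qed.

Lemma tau_positive_functional mu : positive_functional (tau mu).
Proof.
split.
- move=> f g cf cg; rewrite /tau RintegralD//; exact: continuous_integrable.
- move=> a f cf; rewrite /tau RintegralZl//; exact: continuous_integrable.
- by move=> f cf f0; apply: Rintegral_ge0 => x _; exact: f0.
- rewrite /tau Rintegral_cst//.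
  rewrite mul1r; transitivity (fine (1%E : \bar R)) => //.
  by congr fine; exact: probability_setT.
Qed.

(** Markov's inequality. It serves three times: for the layers in the Riesz theorem, for zero sets
    measured through [chi], and for Chebyshev's bound. *)
Lemma mul_measure_le_tau mu f A (c : R) : continuous f -> (forall x, 0 <= f x) ->
  measurable (A : set (borel X)) -> 0 <= c -> (forall x, A x -> c <= f x) ->
  (c%:E * mu A <= (tau mu f)%:E)%E.
Proof.
move=> cf f0 mA c0 cfA; rewrite -(tauE mu cf).
apply: (@le_trans _ _ (\int[mu]_(x in (A : set (borel X))) c%:E)%E).
  by rewrite integral_cst.
apply: (@le_trans _ _ (\int[mu]_(x in (A : set (borel X))) (f x)%:E)%E).
  apply: ge0_le_integral => //.
  by apply/measurable_EFinP; apply: measurable_funS (continuous_borel cf).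
apply: ge0_subset_integral => //; first by apply/measurable_EFinP; exact: continuous_borel.
by move=> x _; rewrite lee_fin.
Qed.

Lemma tau_le_measure mu f A : continuous f -> (forall x, 0 <= f x <= 1) ->
  measurable (A : set (borel X)) -> (forall x, ~ A x -> f x = 0) ->
  ((tau mu f)%:E <= mu A)%E.
Proof.
move=> cf f01 mA fA; rewrite -(tauE mu cf).
apply: (@le_trans _ _ (\int[mu]_x (\1_(A : set (borel X)) x)%:E)%E); last first.
  by rewrite integral_indic// setIT.
apply: ge0_le_integral => //=.
- by move=> x _; rewrite lee_fin; have /andP[] := f01 x.
- by apply/measurable_EFinP; exact: continuous_borel.
- by apply/measurable_EFinP; exact: measurable_indic.
move=> x _; rewrite lee_fin indicE.
case: (boolP (x \in A)) => xA; first by have /andP[] := f01 x.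
by rewrite fA//; move: xA; rewrite notin_setE.
Qed.

End borel_probability.

(** * The outer measure of a positive functional *)

Section riesz.
Context {R : realType} {X : pseudoPMetricType R}.
Variable L : (X -> R) -> R.
Hypotheses (cX : compact [set: X]) (pL : positive_functional L).
Implicit Types (f g h : X -> R) (U V A : set X).

(** The relation between [h] and [U] in the Riesz construction, with vanishing off [U] in place of
    support inside [U]. The margin that the support would give is recovered later by cutting [h]
    down to [max (h - e) 0]. *)
Definition subordinate h U := [/\ continuous h, forall x, 0 <= h x <= 1 &
  forall x, ~ U x -> h x = 0].

Definition inner_content U := sup [set L h | h in subordinate^~ U].

Definition riesz_outer A :=
  inf [set inner_content U | U in [set U | open U /\ A `<=` U]].

Lemma subordinate_cst0 U : subordinate (fun=> 0) U.
Proof.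
by split => // [|x]; [exact: continuous_fun_cst|rewrite lexx ler01].
Qed.

Lemma subordinate_le1 h U : subordinate h U -> L h <= 1.
Proof.
by move=> [ch h01 _]; apply: (pf_le_cst pL ch) => x; have /andP[] := h01 x.
Qed.

Lemma subordinate_le_inner h U : subordinate h U -> L h <= inner_content U.
Proof.
move=> hU; apply: ub_le_sup; last by exists h.
by exists 1 => _ [g gU <-]; exact: subordinate_le1 gU.
Qed.

Lemma inner_content_le U (c : R) : (forall h, subordinate h U -> L h <= c) ->
  inner_content U <= c.
Proof.
move=> Uc; apply: ge_sup; last by move=> _ [h hU <-]; exact: Uc.
by exists (L (fun=> 0)); exists (fun=> 0) => //; exact: subordinate_cst0.
Qed.

Lemma inner_content_ge0 U : 0 <= inner_content U.
Proof.
by rewrite -[leLHS](pf_cst pL); exact/subordinate_le_inner/subordinate_cst0.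
Qed.

Lemma inner_content_le1 U : inner_content U <= 1.
Proof. by apply: inner_content_le => h; exact: subordinate_le1. Qed.

Lemma inner_contentS U V : U `<=` V -> inner_content U <= inner_content V.
Proof.
move=> UV; apply: inner_content_le => h [ch h01 hU].
by apply: subordinate_le_inner; split => // x Vx; apply: hU => /UV.
Qed.

Lemma inner_contentT : inner_content setT = 1.
Proof.
apply/eqP; rewrite eq_le inner_content_le1/= -{1}(pf_cst pL 1).
apply: subordinate_le_inner; split => [|x|x []//].
  exact: continuous_fun_cst.
by rewrite ler01 lexx.
Qed.

(** Guards against the default value of [inf]: [setT] is always a competitor and 0 is a lower
    bound. *)
Let riesz_outer_has_inf A :
  has_inf [set inner_content U | U in [set U | open U /\ A `<=` U]].
Proof.
split; first by exists (inner_content setT); exists setT => //; split => //; exact: openT.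
by exists 0 => _ [U _ <-]; exact: inner_content_ge0.
Qed.

Lemma riesz_outer_le U A : open U -> A `<=` U -> riesz_outer A <= inner_content U.
Proof.
move=> oU AU; apply: ge_inf; last by exists U.
by case: (riesz_outer_has_inf A).
Qed.

Lemma le_riesz_outer A (c : R) :
  (forall U, open U -> A `<=` U -> c <= inner_content U) -> c <= riesz_outer A.
Proof.
move=> Ac; apply: lb_le_inf; first by case: (riesz_outer_has_inf A).
by move=> _ [U [oU AU] <-]; exact: Ac.
Qed.

Lemma riesz_outer_adherent A (e : R) : 0 < e -> exists U,
  [/\ open U, A `<=` U & inner_content U <= riesz_outer A + e].
Proof.
move=> e0; have [_ [U [oU AU] <-] /ltW Ue] :=
  inf_adherent e0 (riesz_outer_has_inf A).
by exists U.
Qed.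

Lemma riesz_outer_open U : open U -> riesz_outer U = inner_content U.
Proof.
move=> oU; apply/eqP; rewrite eq_le riesz_outer_le//=.
by apply: le_riesz_outer => V _; exact: inner_contentS.
Qed.

Lemma riesz_outer_ge0 A : 0 <= riesz_outer A.
Proof. by apply: le_riesz_outer => U _ _; exact: inner_content_ge0. Qed.

Lemma riesz_outerS A B : A `<=` B -> riesz_outer A <= riesz_outer B.
Proof.
move=> AB; apply: le_riesz_outer => U oU BU; apply: riesz_outer_le => //.
exact: subset_trans BU.
Qed.

Lemma riesz_outer0 : riesz_outer set0 = 0.
Proof.
apply/eqP; rewrite eq_le riesz_outer_ge0 andbT riesz_outer_open; last exact: open0.
apply: inner_content_le => h [ch _ h0]; apply: (pf_le_cst pL ch) => x.
by rewrite h0.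
Qed.

(* Compactness provides [n] with [h <= min h (n * (p 0 + .. + p (n - 1))) + e]
   for cutoff functions [p i] of the [U i]; the increments of these minima
   are subordinate to the [U i]. *)
Lemma inner_content_bigcup (U : nat -> set X) (h : X -> R) (e : R) :
  (forall n, open (U n)) -> subordinate h (\bigcup_n U n) -> 0 < e ->
  exists n, L h <= \sum_(i < n) inner_content (U i) + e.
Proof.
move=> oU [ch h01 hU] e0.
have /choice[p pP] := fun n => exists_cutoff (oU n).
have cp n : continuous (p n) by case: (pP n).
have p0 n x : 0 <= p n x by case: (pP n).
pose S n x := \sum_(i < n) p i x.
have cS n : continuous (S n) by exact: continuous_fun_sum.
have S0 n x : 0 <= S n x by exact: sumr_ge0.
(* Compactness reduces this uniform bound to a local one. Near a given point either [h < e], or the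
   point lies in some [U k] and [n * p k > 1 >= h] nearby for all large [n]. *)
have : \forall n \near \oo, [set: X] `<=` (fun x => h x - e < n%:R * S n x).
  move/compact_near_coveringP : cX; apply => x _.
  have [hxe|exh] := ltP (h x) e.
    have : nbhs x [set y | h y < e].
      by apply: open_nbhs_nbhs; split => //; exact: open_lt_fun.
    move=> xe; exists ([set y | h y < e], setT) => /=.
      by split => //; exact: filterT.
    move=> [y n] /= [hye _]; apply: (@lt_le_trans _ _ 0); first by rewrite subr_lt0.
    by rewrite mulr_ge0.
  have [k _ Ukx] : (\bigcup_n U n) x.
    by apply: contrapT => /hU hx0; move: exh; rewrite hx0 leNgt e0.
  have pkx : 0 < p k x by case: (pP k) => _ _ /(_ _ Ukx).
  have near_x : nbhs x [set y | p k x / 2 < p k y].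
    apply: open_nbhs_nbhs; split; first exact: open_gt_fun.
    by rewrite /= ltr_pdivrMr// ltr_pMr// ltr1n.
  have near_oo : \forall n \near \oo, (k < n)%N /\ (p k x / 2)^-1 <= n%:R.
    near=> n; split; first by near: n; exact: nbhs_infty_gt.
    by near: n; exact: nbhs_infty_ger.
  exists ([set y | p k x / 2 < p k y],
    [set n | (k < n)%N /\ (p k x / 2)^-1 <= n%:R]) => //=.
  move=> [y n] /= [py [kn pn]].
  have pkS : p k y <= S n y.
    by rewrite /S (bigD1 (Ordinal kn))//= lerDl sumr_ge0.
  have : 1 < n%:R * S n y.
    apply: (@lt_le_trans _ _ (n%:R * p k y)); last by rewrite ler_wpM2l.
    apply: (@le_lt_trans _ _ (n%:R * (p k x / 2))).
      by rewrite -ler_pdivrMr ?divr_gt0// div1r.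
    rewrite ltr_pM2l// (lt_le_trans _ pn)// invr_gt0 divr_gt0//.
  apply: lt_trans; have /andP[_ h1] := h01 y.
  by rewrite ltrBlDr (le_lt_trans h1)// ltrDl.
move=> [n _ /(_ n (leqnn n)) hn]; exists n.
pose m k x := Num.min (h x) (n%:R * S k x).
have cm k : continuous (m k).
  apply: continuous_fun_min => //.
  by apply: continuous_fun_mul => //; exact: continuous_fun_cst.
have Lm k : L (m k) <= \sum_(i < k) inner_content (U i).
  elim: k => [|k IH].
    rewrite big_ord0; apply: (pf_le_cst pL (cm _)) => x.
    by rewrite /m /S big_ord0 mulr0 ge_min lexx orbT.
  rewrite big_ord_recr/= -lerBlDl.
  apply: (@le_trans _ _ (L (m k.+1) - L (m k))); first by rewrite lerB.
  rewrite -pf_sub//; apply: subordinate_le_inner; split.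
  - exact: continuous_fun_sub.
  - move=> x; have /andP[h0 h1] := h01 x.
    have mk0 : 0 <= m k x by rewrite /m le_min h0 mulr_ge0.
    have mk1 : m k.+1 x <= h x by rewrite /m ge_min lexx.
    apply/andP; split; last by lra.
    rewrite subr_ge0 /m le_min ge_min lexx/= ge_min; apply/orP; right.
    by rewrite /S big_ord_recr/= ler_wpM2l// lerDl.
  - move=> x Ux; rewrite /m /S big_ord_recr/=.
    by case: (pP k) => _ _ _ /(_ _ Ux) ->; rewrite addr0 subrr.
apply: (@le_trans _ _ (L (m n) + e)); last by rewrite lerD2r.
rewrite -[X in _ + X](pf_cst pL) -pf_add//; last exact: continuous_fun_cst.
apply: pf_le => //; first by apply: continuous_fun_add => //; exact: continuous_fun_cst.
move=> x; rewrite -lerBlDr /m le_min gerBl (ltW e0)/=.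
exact/ltW/hn.
Unshelve. all: by end_near. Qed.

(** Half of the slack [e] is spent geometrically on enlarging each [A n] to an open [U n], the other
    half on passing to finitely many [U n] by compactness. *)
Lemma riesz_outer_bigcup (A : nat -> set X) :
  ((riesz_outer (\bigcup_n A n))%:E <= \sum_(n <oo) (riesz_outer (A n))%:E)%E.
Proof.
apply/lee_addgt0Pr => e e0.
have e20 : 0 < e / 2 by rewrite divr_gt0.
have e2n n : 0 < e / 2 / (2 ^ n.+1)%:R :> R by rewrite divr_gt0// ltr0n expn_gt0.
have /choice[U UP] := fun n => riesz_outer_adherent (A n) (e2n n).
have oU n : open (U n) by case: (UP n).
apply: (@le_trans _ _
  (\sum_(n <oo) ((riesz_outer (A n))%:E + (e / 2 / (2 ^ n.+1)%:R)%:E) +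
   (e / 2)%:E)%E); last first.
  rewrite [in leRHS](splitr e) EFinD addeA leeD2r//.
  by apply: epsilon_trick; [move=> n; rewrite lee_fin riesz_outer_ge0|exact: ltW].
apply: (@le_trans _ _ (inner_content (\bigcup_n U n))%:E).
  rewrite lee_fin riesz_outer_le//; first exact: bigcup_open.
  by apply: subset_bigcup => n _; case: (UP n).
set s := (\sum_(_ <oo) _)%E.
have s0 : (0 <= s)%E.
  by apply: nneseries_ge0 => n _ _; rewrite -EFinD lee_fin addr_ge0 ?riesz_outer_ge0// ltW.
have hs h : subordinate h (\bigcup_n U n) -> ((L h)%:E <= s + (e / 2)%:E)%E.
  move=> /(inner_content_bigcup oU)/(_ e20)[n Ln].
  apply: (@le_trans _ _ (\sum_(i < n) inner_content (U i) + e / 2)%:E).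
    by rewrite lee_fin.
  rewrite EFinD leeD2r//.
  apply: (@le_trans _ _ (\sum_(0 <= i < n)
      ((riesz_outer (A i))%:E + (e / 2 / (2 ^ i.+1)%:R)%:E))%E).
    rewrite big_mkord -sumEFin; apply: lee_sum => i _.
    by rewrite -EFinD lee_fin; case: (UP i).
  apply: nneseries_lim_ge => i _ _.
  by rewrite -EFinD lee_fin addr_ge0 ?riesz_outer_ge0// ltW.
(* The series may diverge; only a finite sum [r] leaves something to prove, and then the bound
   passes to the supremum over [h]. *)
case: s s0 hs => [r r0 hs|_ _|//]; last by rewrite addye// leey.
rewrite -EFinD lee_fin; apply: inner_content_le => h /hs.
by rewrite -EFinD lee_fin.
Qed.

End riesz.

(** * Riesz representation *)

Section riesz_representation.
Context {R : realType} {X : pseudoPMetricType R}.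
Variable L : (X -> R) -> R.
Hypotheses (cX : compact [set: X]) (pL : positive_functional L).
Implicit Types (f g h : X -> R) (U V A : set X).

Let riesz_outer_EFin A : \bar R := (riesz_outer L A)%:E.

Let nu : {outer_measure set X -> \bar R} :=
  HB.pack riesz_outer_EFin (isOuterMeasure.Build R X riesz_outer_EFin
    (congr1 EFin (riesz_outer0 pL))
    (fun A => riesz_outer_ge0 pL A)
    (fun A B AB => riesz_outerS pL AB)
    (riesz_outer_bigcup cX pL)).

(** The points of [V] outside [U] lie in the open set [V] intersected with [{h < e}]. A function [g]
    subordinate to that set vanishes wherever [max (h - e) 0] is positive, so their sum is
    subordinate to [V], and the cut costs at most [e]. *)
Lemma subordinate_add_le V U h (e : R) : open V -> open U -> 0 < e ->
  subordinate h (V `&` U) -> L h + riesz_outer L (V `\` U) <= inner_content L V + e.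
Proof.
move=> oV oU e0 [ch h01 hVU].
have oW : open (V `&` [set x | h x < e]) by apply: openI => //; exact: open_lt_fun.
have : riesz_outer L (V `\` U) <= inner_content L (V `&` [set x | h x < e]).
  apply: riesz_outer_le => // x [Vx Ux]; split => //=.
  by rewrite hVU// => -[].
rewrite -(lerD2l (L h)) => /le_trans; apply.
rewrite -lerBrDl; apply: inner_content_le => // g [cg g01 gW].
rewrite lerBrDl -lerBlDr.
pose k x := Num.max (h x - e) 0.
have ck : continuous k.
  apply: continuous_fun_max; last exact: continuous_fun_cst.
  by apply: continuous_fun_sub => //; exact: continuous_fun_cst.
have Lhk : L h - e <= L k.
  rewrite -[X in _ - X](pf_cst pL) -pf_sub//; last exact: continuous_fun_cst.
  apply: pf_le => //; first by apply: continuous_fun_sub => //; exact: continuous_fun_cst.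
  by move=> x; rewrite /k le_max lexx.
apply: (@le_trans _ _ (L k + L g)); first by lra.
rewrite -pf_add//; apply: subordinate_le_inner => //; split.
- exact: continuous_fun_add.
- move=> x; have /andP[h0 h1] := h01 x; have /andP[g0 g1] := g01 x.
  rewrite /k; have [hxe|exh] := ltP (h x) e.
    by rewrite max_r ?add0r ?g01//; lra.
  rewrite gW; last by move=> [_ /=]; rewrite ltNge exh.
  by rewrite max_l; [apply/andP; split; lra|lra].
- move=> x Vx; rewrite /k hVU; last by case.
  by rewrite gW ?addr0 ?max_r//; [lra|case].
Qed.

(** It suffices to split an open [V] containing [A]; there [V] and [U] meet in an open set, whose
    content is a supremum over subordinate functions. *)
Lemma open_caratheodory U : open U -> nu.-caratheodory U.
Proof.
move=> oU; apply: le_caratheodory_measurable => A.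
rewrite /= /riesz_outer_EFin -EFinD lee_fin.
apply: le_riesz_outer => // V oV AV.
apply/ler_addgt0Pr => e e0.
have oVU : open (V `&` U) by exact: openI.
apply: (@le_trans _ _ (inner_content L (V `&` U) + riesz_outer L (V `\` U))).
  apply: lerD; last by apply: riesz_outerS => //; exact: setSI.
  by apply: riesz_outer_le => //; exact: setSI.
rewrite -lerBrDr; apply: inner_content_le => // h hVU.
by rewrite lerBrDr; exact: subordinate_add_le.
Qed.

Lemma borel_caratheodory (A : set (borel X)) :
  measurable A -> nu.-caratheodory A.
Proof.
apply: smallest_sub => //; last exact: open_caratheodory.
split.
- exact: caratheodory_measurable_set0.
- by move=> B mB; rewrite setTD; exact: caratheodory_measurable_setC.
- by move=> F mF; exact: caratheodory_measurable_bigcup.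
Qed.

Let riesz_sigma_additive :
  semi_sigma_additive (riesz_outer_EFin : set (borel X) -> \bar R).
Proof.
move=> F mF tF mUF.
apply: (@caratheodory_measure_sigma_additive R X nu F) => //.
- by move=> i; exact: borel_caratheodory.
- exact: borel_caratheodory.
Qed.

Let riesz_setT : riesz_outer_EFin setT = 1%E.
Proof.
by rewrite /riesz_outer_EFin (riesz_outer_open pL openT) (inner_contentT pL).
Qed.

Let riesz_measure : {measure set (borel X) -> \bar R} :=
  HB.pack (riesz_outer_EFin : set (borel X) -> \bar R)
    (isMeasure.Build _ (borel X) R (riesz_outer_EFin : set (borel X) -> \bar R)
      (congr1 EFin (riesz_outer0 pL)) (fun A => riesz_outer_ge0 pL A)
      riesz_sigma_additive).

(** Only open sets are recorded because the layer cake argument measures nothing but strict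
    superlevel sets. *)
Lemma exists_riesz_probability : exists mu : BorelProb R X,
  forall U, open U -> mu (U : set (borel X)) = (inner_content L U)%:E.
Proof.
pose mu : BorelProb R X := HB.pack
  (riesz_outer_EFin : set (borel X) -> \bar R) riesz_measure
  (Measure_isProbability.Build _ (borel X) R riesz_measure riesz_setT).
exists mu => U oU.
by rewrite /= /riesz_outer_EFin riesz_outer_open.
Qed.

(* Layer cake with step [e]: the [k]-th layer of [h] is at most [e] on
   [{h > (k + 1) e}], where the previous layer equals [e]. *)
Lemma functional_le_tau_layer (mu : BorelProb R X) h (e : R) (k : nat) :
  (forall U, open U -> mu (U : set (borel X)) = (inner_content L U)%:E) ->
  continuous h -> (forall x, 0 <= h x) -> 0 < e ->
  L (fun x => Num.min (h x) (k.+1%:R * e)) <=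
    e + tau mu (fun x => Num.min (h x) (k%:R * e)).
Proof.
move=> muU ch h0 e0.
have pT := tau_positive_functional cX mu.
pose m k x := Num.min (h x) (k%:R * e).
have cm i : continuous (m i) by apply: continuous_fun_min => //; exact: continuous_fun_cst.
have m0 i x : 0 <= m i x by rewrite /m le_min h0 mulr_ge0// ltW.
rewrite -/(m k.+1) -/(m k); elim: k => [|k IH].
  apply: (@le_trans _ _ e).
    by apply: (pf_le_cst pL (cm _)) => x; rewrite /m mul1r ge_min lexx orbT.
  by rewrite lerDl; apply: (pf_ge0 pT).
pose U := [set x | k.+1%:R * e < h x].
have oU : open U by exact: open_gt_fun.
have stepE i : i.+1%:R * e = i%:R * e + e by rewrite -natr1 mulrDl mul1r.
have LU : L (fun x => m k.+2 x - m k.+1 x) <= e * inner_content L U.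
  rewrite -ler_pdivrMl// -(pf_scale pL); last exact: continuous_fun_sub.
  apply: subordinate_le_inner => //; split.
  - apply: continuous_fun_mul; first exact: continuous_fun_cst.
    exact: continuous_fun_sub.
  - move=> x; rewrite ler_pdivlMl// ler_pdivrMl// mulr0 mulr1 /m (stepE k.+1).
    by rewrite !minEle; do 2 case: ifPn; rewrite -?ltNge; lra.
  - move=> x /negP; rewrite -leNgt => hx; rewrite /m !min_l ?subrr ?mulr0//.
    by rewrite (stepE k.+1); lra.
have TU : e * inner_content L U <= tau mu (fun x => m k.+1 x - m k x).
  rewrite -lee_fin EFinM -muU//; apply: mul_measure_le_tau => //.
  - exact: continuous_fun_sub.
  - by move=> x; rewrite /m (stepE k) !minEle; do 2 case: ifPn; rewrite -?ltNge; lra.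
  - exact: open_borel.
  - exact: ltW.
  - move=> x; rewrite /U /= => Ux.
    by rewrite /m (stepE k) !min_r; rewrite ?(stepE k) in Ux *; lra.
have := le_trans LU TU; rewrite (pf_sub pL)// (pf_sub pT)//.
lra.
Qed.

(** The layer estimate gives [L h <= tau mu h] for nonnegative [h]. Adding a constant extends this
    to all continuous functions, and applying it to the opposite function gives equality. *)
Lemma riesz_representation : exists mu : BorelProb R X,
  forall f, continuous f -> tau mu f = L f.
Proof.
have [mu muU] := exists_riesz_probability; exists mu.
have pT := tau_positive_functional cX mu.
have le_ge0 h : continuous h -> (forall x, 0 <= h x) -> L h <= tau mu h.
  move=> ch h0; apply/ler_addgt0Pr => e e0.
  have [M M0 hM] := continuous_bounded cX ch.
  (* With [k * e >= M], both truncations in the layer estimate are equal to [h]. *)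
  pose k := (Num.truncn (M / e)).+1.
  have Mk : M <= k%:R * e by rewrite -ler_pdivrMr// ltW// truncnS_gt.
  have minE i : (k <= i)%N -> (fun x => Num.min (h x) (i%:R * e)) = h.
    move=> ki; apply/funext => x; rewrite min_l//.
    rewrite (le_trans (ler_norm _))// (le_trans (hM x))// (le_trans Mk)//.
    by rewrite ler_wpM2r ?ler_nat// ltW.
  have := functional_le_tau_layer k muU ch h0 e0.
  by rewrite !minE// addrC.
have le_gen f : continuous f -> L f <= tau mu f.
  move=> cf; have [M M0 fM] := continuous_bounded cX cf.
  have := le_ge0 (fun x => f x + M); rewrite (pf_add pL)// ?(pf_add pT)//;
    try exact: continuous_fun_cst.
  rewrite (pf_cst pL) (pf_cst pT) lerD2r; apply.
    by apply: continuous_fun_add => //; exact: continuous_fun_cst.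
  by move=> x; have := fM x; rewrite ler_norml => /andP[]; lra.
move=> f cf; apply/eqP; rewrite eq_le le_gen// andbT.
have := le_gen (fun x => 0 - f x); rewrite (pf_sub pL)// ?(pf_sub pT)//;
  try exact: continuous_fun_cst.
rewrite (pf_cst pL) (pf_cst pT) => /(_ _).
rewrite lerD2l lerN2; apply.
by apply: continuous_fun_sub => //; exact: continuous_fun_cst.
Qed.

End riesz_representation.

(** * Weak* compactness and zero sets *)

Lemma fmap_ultra (T U : Type) (f : T -> U) (F : set_system T) :
  UltraFilter F -> UltraFilter (f @ F).
Proof.
move=> FU; split; first exact: fmap_proper_filter.
move=> G GF FG; apply/seteqP; split => // B GB.
have [//|FnB] := in_ultra_setVsetC (f @^-1` B) FU.
have /FG GnB : (f @ F) (~` B) by [].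
by have [x []] := @filter_ex _ G GF _ (@filterI _ G _ _ _ GB GnB).
Qed.

Section weak_star_compactness.
Context {R : realType} {X : pseudoPMetricType R}.
Hypothesis cX : compact [set: X].
Implicit Types f g : X -> R.

(** The values stay in the compact interval [[-M, M]], where every ultrafilter converges. *)
Lemma tau_ultra_cvg (mu : nat -> BorelProb R X) (G : set_system nat) f :
  UltraFilter G -> continuous f -> cvg ((fun n => tau (mu n) f) @ G).
Proof.
move=> GU cf; have [M M0 fM] := continuous_bounded cX cf.
have : compact `[- M, M]%classic by exact: segment_compact.
rewrite compact_ultra => /(_ _ (fmap_ultra (fun n => tau (mu n) f) GU)).
case; last by move=> l [_ fl]; apply/cvg_ex; exists l.
rewrite /= /nbhs/=; apply: filterE => n /=; rewrite in_itv/=.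
have pT := tau_positive_functional cX (mu n).
apply/andP; split.
  by apply: (pf_ge_cst pT cf) => x; have := fM x; rewrite ler_norml => /andP[].
by apply: (pf_le_cst pT cf) => x; have := fM x; rewrite ler_norml => /andP[].
Qed.

(** A single ultrafilter makes the values converge for every continuous function at once, so the
    laws pass to the limit. *)
Lemma ultra_lim_positive_functional (mu : nat -> BorelProb R X)
    (G : set_system nat) : UltraFilter G ->
  positive_functional (fun f => lim ((fun n => tau (mu n) f) @ G)).
Proof.
move=> GU; have pT n := tau_positive_functional cX (mu n).
split.
- move=> f g cf cg; apply/cvg_lim => //.
  under eq_fun do rewrite (pf_add (pT _))//.
  by apply: cvgD; exact: tau_ultra_cvg.
- move=> a f cf; apply/cvg_lim => //.
  under eq_fun do rewrite (pf_scale (pT _))//.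
  by apply: cvgM; [exact: cvg_cst|exact: tau_ultra_cvg].
- move=> f cf f0; apply: limr_ge; first exact: tau_ultra_cvg.
  by apply: filterE => n; exact: (pf_ge0 (pT n)).
- apply/cvg_lim => //; under eq_fun do rewrite (pf_one (pT _)).
  exact: cvg_cst.
Qed.

(** For [k >= n], monotonicity gives [eps <= tau (mu k) (h k) <= tau (mu k) (h n)]; then let [k] go
    to the limit with [n] fixed. *)
Lemma weak_star_closed_cluster (Delta : set (BorelProb R X))
    (h : nat -> X -> R) (eps : R) :
  weak_star_closed Delta -> (forall n, continuous (h n)) ->
  (forall m n, (m <= n)%N -> forall x, h n x <= h m x) ->
  (forall n, exists2 mu, Delta mu & eps <= tau mu (h n)) ->
  exists2 mu, Delta mu & forall n, eps <= tau mu (h n).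
Proof.
move=> hD ch hdec hDn.
have /choice[mu muP] : forall n, exists mu, Delta mu /\ eps <= tau mu (h n).
  by move=> n; have [mu ? ?] := hDn n; exists mu.
have [G [GU ooG]] := ultraFilterLemma eventually_filter.
have [m mE] := riesz_representation cX (ultra_lim_positive_functional mu GU).
exists m => [|n].
  (* A basic neighbourhood tests finitely many functions, so the filter handles them
     simultaneously. *)
  apply: hD => n f cf e e0.
  have : \forall k \near G, forall i, `|tau (mu k) (f i) - tau m (f i)| < e.
    apply: filter_forall => i; rewrite mE//.
    have /cvgrPdist_lt/(_ _ e0) := @tau_ultra_cvg mu G (f i) GU (cf i).
    by apply: filterS => k; rewrite distrC.
  move=> /filter_ex[k hk]; exists (mu k); split => //.
  by case: (muP k).
rewrite mE//; apply: limr_ge; first exact: tau_ultra_cvg.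
apply: ooG; near=> k.
case: (muP k) => _ /le_trans; apply.
apply: (pf_le (tau_positive_functional cX (mu k))) => //.
by apply: hdec; near: k; exact: nbhs_infty_ge.
Unshelve. all: by end_near. Qed.

Lemma measure_zero_set_uniform (Delta : set (BorelProb R X)) g (eps : R) :
  weak_star_closed Delta -> continuous g -> 0 < eps ->
  (forall mu, Delta mu ->
    (mu (g @^-1` [set 0%R] : set (borel X)) < eps%:E)%E) <->
  (exists2 delta : R, 0 < delta &
    forall mu, Delta mu -> tau mu (chi delta \o g) < eps).
Proof.
move=> hD cg e0.
have cchi d : 0 < d -> continuous (chi d \o g).
  by move=> d0 x; apply: continuous_comp; [exact: cg|exact: chi_continuous].
split => [mu0|[d d0 hd] mu Dmu].
  apply: contrapT => /forall2NP hd.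
  pose d n : R := n.+1%:R^-1.
  have d0 n : 0 < d n by rewrite invr_gt0 ltr0n.
  have [] := @weak_star_closed_cluster Delta (fun n => chi (d n) \o g) eps hD.
  - by move=> n; exact: cchi.
  - move=> m n mn x /=; apply: le_chi => //.
    by rewrite /d lef_pV2 ?posrE// ler_nat.
  - move=> n; apply: contrapT => /forall2NP hn.
    have [//|] := hd (d n); apply => mu Dmu; rewrite ltNge.
    by apply/negP => emu; have [] := hn mu.
  move=> mu Dmu muP.
  have := mu0 mu Dmu; rewrite ltNge => /negP; apply.
  (* [chi (d n) \o g] vanishes off [F n], and the sets [F n] decrease to the zero set of [g];
     continuity from above turns the lower bound [eps] into one for [mu (g = 0)]. *)
  pose F n := [set x | `|g x| <= d n].
  have cF n : closed (F n) by apply: closed_le_fun; exact: continuous_fun_norm.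
  have FE : g @^-1` [set 0%R] = \bigcap_n F n.
    apply/seteqP; split => x /=.
      by move=> gx n _; rewrite /F /= gx normr0 ltW.
    move=> Fx; apply/eqP; rewrite -normr_le0; apply/ler_addgt0Pr => e e1.
    rewrite add0r; apply: (le_trans (Fx (Num.truncn e^-1) I)).
    rewrite /d -[leRHS]invrK lef_pV2 ?posrE ?invr_gt0//.
    by rewrite ltW// truncnS_gt.
  have mF n : measurable (F n : set (borel X)) by exact: closed_borel.
  have : mu (F n : set (borel X)) @[n --> \oo] -->
      mu (\bigcap_n F n : set (borel X)).
    apply: nonincreasing_cvg_mu => //.
    - exact: (le_lt_trans (probability_le1 mu (mF 0%N)) (ltry 1)).
    - exact: bigcapT_measurable.
    - move=> m n mn; apply/subsetPset => x; rewrite /F /= => /le_trans; apply.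
      by rewrite /d lef_pV2 ?posrE// ler_nat.
  move=> cvgF; rewrite FE -(cvg_lim _ cvgF)//.
  apply: lime_ge; first by apply/cvg_ex; eexists; exact: cvgF.
  apply: nearW => n; apply: (@le_trans _ _ (tau mu (chi (d n) \o g))%:E).
    by rewrite lee_fin.
  apply: tau_le_measure => //; first exact: cchi.
  - by move=> x /=; rewrite chi_ge0 ?chi_le1.
  - by move=> x /negP; rewrite -ltNge => dx /=; rewrite chi_eq0.
(* Converse: [chi d \o g] equals 1 on the zero set. *)
apply: le_lt_trans (_ : ((tau mu (chi d \o g))%:E < eps%:E)%E); last first.
  by rewrite lte_fin; exact: hd.
rewrite -[leLHS]mul1e; apply: mul_measure_le_tau => //; first exact: cchi.
- by move=> x; exact: chi_ge0.
- apply: closed_borel; exact: closed_zero_set.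
- move=> x /= ->; rewrite chi_eq1// normr0 divr_gt0//.
Qed.

End weak_star_compactness.

(** * Small boundaries and uniform approximation *)

Lemma boundaryU (T : topologicalType) (A B : set T) :
  boundary (A `|` B) `<=` boundary A `|` boundary B.
Proof.
move=> x [clAB intAB].
have nA : ~ interior A x.
  by move=> iA; apply: intAB; apply: interiorS iA; exact: subsetUl.
have nB : ~ interior B x.
  by move=> iB; apply: intAB; apply: interiorS iB; exact: subsetUr.
by move: clAB; rewrite closureU => -[|]; [left|right].
Qed.

Lemma boundary_borel (X : ptopologicalType) (V : set X) :
  measurable (boundary V : set (borel X)).
Proof.
apply: measurableD; first by apply: closed_borel; exact: closed_closure.
by apply: open_borel; exact: open_interior.
Qed.

Lemma boundary_set0 (T : topologicalType) : boundary (@set0 T) = set0.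
Proof. by rewrite /boundary closure0 set0D. Qed.

Lemma continuous_norm_sqr (R : realType) (T : topologicalType) (f : T -> R) :
  continuous f -> continuous (fun x => `|f x| ^+ 2).
Proof.
move=> cf; under eq_fun do rewrite expr2.
by apply: continuous_fun_mul; exact: continuous_fun_norm.
Qed.

Section small_boundary.
Context {R : realType} {X : pseudoPMetricType R}.
Hypothesis cX : compact [set: X].
Variable Delta : set (BorelProb R X).
Implicit Types f g h : X -> R.

Definition null_boundary (V : set X) := forall mu, Delta mu ->
  mu (boundary V : set (borel X)) = 0%E.

Lemma null_boundaryU (V W : set X) :
  null_boundary V -> null_boundary W -> null_boundary (V `|` W).
Proof.
move=> nV nW mu Dmu; apply/eqP; rewrite eq_le measure_ge0 andbT.
have mV := boundary_borel V; have mW := boundary_borel W.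
apply: (@le_trans _ _ (mu (boundary V `|` boundary W : set (borel X)))).
  apply: le_measure; rewrite ?in_setE//; last exact: boundaryU.
    exact: boundary_borel.
  exact: measurableU.
have : (mu (boundary V `|` boundary W : set (borel X)) <=
    mu (boundary V : set (borel X)) + mu (boundary W : set (borel X)))%E.
  exact: measureU2.
by rewrite (nV mu Dmu) (nW mu Dmu) adde0.
Qed.

(** Finitely many small-boundary neighbourhoods cover the compact set [C], and the boundary of a
    finite union lies in the union of the boundaries. *)
Lemma SBP_separation (C U : set X) : SBP Delta -> closed C -> open U ->
  C `<=` U -> exists V, [/\ open V, C `<=` V, V `<=` U & null_boundary V].
Proof.
move=> sbp cC oU CU.
have /choice[V VP] : forall x, exists V,
    [/\ open V, V `<=` U, null_boundary V & C x -> V x].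
  move=> x; have [Cx|nCx] := pselect (C x).
    by have [V [oV Vx VU nV]] := sbp x U oU (CU x Cx); exists V.
  (* Points outside [C] receive the empty set, which makes the choice function total. *)
  exists set0; split => //; first exact: open0.
  by move=> mu _; rewrite boundary_set0 measure0.
have : compact C by exact: (subclosed_compact cC cX).
rewrite compact_cover => /(_ X C V).
case=> [x _|x Cx|D _ CD]; first by case: (VP x).
  by exists x => //; case: (VP x) => _ _ _; exact.
rewrite /cover bigcup_fset in CD.
pose W := \big[setU/set0]_(x <- D) V x.
suff [oW WU nW] : [/\ open W, W `<=` U & null_boundary W] by exists W.
rewrite /W; elim/big_ind : _.
- split => //; first exact: open0.
  by move=> mu _; rewrite boundary_set0 measure0.
- move=> A B [oA AU nA] [oB BU nB]; split; first exact: openU.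
    by rewrite subUset.
  exact: null_boundaryU.
- by move=> x _; case: (VP x).
Qed.

Lemma norm2Delta_le f (c : R) : continuous f -> 0 <= c ->
  (forall x, `|f x| <= c) -> (norm2Delta Delta f <= c%:E)%E.
Proof.
move=> cf c0 fc; apply: ge_ereal_sup => _ [mu Dmu <-].
rewrite lee_fin -[leRHS](ger0_norm c0) -sqrtr_sqr.
apply: ler_wsqrtr; apply: (pf_le_cst (tau_positive_functional cX mu)).
  exact: continuous_norm_sqr.
by move=> x; rewrite ler_pXn2r// nnegrE.
Qed.

Lemma SBP_dense f (eps : R) : SBP Delta -> continuous f -> 0 < eps ->
  exists g, [/\ continuous g,
    (norm2Delta Delta (fun x => f x - g x)%R < eps%:E)%E &
    forall mu, Delta mu -> mu (g @^-1` [set 0%R] : set (borel X)) = 0%E].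
Proof.
(* The function [g] will be within [2 * d = eps / 2] of [f]; the remaining factor keeps the
   inequality strict after the supremum. *)
move=> sbp cf e0; pose d := eps / 4; have d0 : 0 < d by rewrite divr_gt0.
have [V [oV CV VU nV]] : exists V, [/\ open V, [set x | 0 <= f x] `<=` V,
    V `<=` [set x | - d < f x] & null_boundary V].
  apply: SBP_separation => //; [exact: closed_ge_fun|exact: open_gt_fun|].
  by move=> x /=; lra.
have [s [cs sV sV']] := exists_sign_function oV.
pose g x := Num.max (f x) (Num.min (f x + 2 * d) (s x)).
have cg : continuous g.
  apply: continuous_fun_max => //; apply: continuous_fun_min => //.
  by apply: continuous_fun_add => //; exact: continuous_fun_cst.
have fg x : `|f x - g x| <= 2 * d.
  rewrite ler_norml /g maxEle minEle.
  by do 2 case: ifPn; rewrite -?ltNge; lra.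
(* On [V], both [f + 2 * d > d] and [s] are positive; off [closure V], both [f] and [s] are
   negative. *)
have gV x : V x -> 0 < g x.
  move=> Vx; rewrite /g lt_max lt_min sV// andbT.
  by apply/orP; right; have := VU _ Vx; rewrite /=; lra.
have gV' x : ~ closure V x -> g x < 0.
  move=> Vx; rewrite /g gt_max gt_min sV'// orbT andbT.
  by rewrite ltNge; apply/negP => /CV /subset_closure.
exists g; split => //.
  apply: (@le_lt_trans _ _ (2 * d)%:E); last by rewrite lte_fin /d; lra.
  by apply: norm2Delta_le => //; [exact: continuous_fun_sub|lra].
move=> mu Dmu; apply/eqP; rewrite eq_le measure_ge0 andbT -(nV mu Dmu).
apply: le_measure; rewrite ?in_setE//.
- by apply: closed_borel; exact: closed_zero_set.
- exact: boundary_borel.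
- move=> x /= gx; split.
    by apply: contrapT => /gV'; rewrite gx ltxx.
  by move=> /interior_subset /gV; rewrite gx ltxx.
Qed.

End small_boundary.

Section density.
Context {R : realType} {X : pseudoPMetricType R}.
Hypothesis cX : compact [set: X].
Variable Delta : set (BorelProb R X).
Implicit Types f g h : X -> R.

Hypothesis dense : forall f, continuous f -> forall eps : R, 0 < eps ->
  exists g, [/\ continuous g,
    (norm2Delta Delta (fun x => (f x - g x)%R) < eps%:E)%E &
    forall mu, Delta mu -> (mu (g @^-1` [set 0%R] : set (borel X)) < eps%:E)%E].

(* Truncating [g0] to [[f - eta, f + eta]] only creates zeros where
   [`|f - g0| >= eta], a set controlled by Chebyshev's inequality. *)
Lemma dense_uniform f (eta eps : R) : continuous f -> 0 < eta -> 0 < eps ->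
  exists g, [/\ continuous g, forall x, `|f x - g x| <= eta &
    forall mu, Delta mu -> (mu (g @^-1` [set 0%R] : set (borel X)) < eps%:E)%E].
Proof.
move=> cf eta0 eps0.
(* The tolerance [e] serves twice: [e <= eps / 2] bounds the zero set of [g0], and
   [e ^+ 2 <= eta ^+ 2 * (eps / 2)], through [q ^+ 2 <= q], is what Chebyshev's inequality
   requires. *)
pose q := Num.min 1 (eps / 2); pose e := Num.min 1 eta * q.
have q0 : 0 < q by rewrite lt_min ltr01 divr_gt0.
have m0 : 0 < Num.min 1 eta by rewrite lt_min ltr01.
have e0 : 0 < e by rewrite mulr_gt0.
have [g0 [cg0 fg0 zg0]] := dense cf e0.
pose g x := Num.max (f x - eta) (Num.min (f x + eta) (g0 x)).
have ceta : continuous (fun _ : X => eta) by exact: continuous_fun_cst.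
have cg : continuous g.
  apply: continuous_fun_max; first exact: continuous_fun_sub.
  by apply: continuous_fun_min => //; exact: continuous_fun_add.
exists g; split => //.
  move=> x; rewrite ler_norml /g maxEle minEle.
  by do 2 case: ifPn; rewrite -?ltNge; lra.
move=> mu Dmu.
pose A := [set x | eta <= `|f x - g0 x|].
have cfg : continuous (fun x => f x - g0 x) by exact: continuous_fun_sub.
have mA : measurable (A : set (borel X)).
  by apply: closed_borel; apply: closed_ge_fun; exact: continuous_fun_norm.
have mZ h : continuous h -> measurable (h @^-1` [set 0%R] : set (borel X)).
  by move=> ch; apply: closed_borel; exact: closed_zero_set.
have gA : g @^-1` [set 0%R] `<=` g0 @^-1` [set 0%R] `|` A.
  move=> x /=; rewrite /g /A /=.
  have [fg|fg] := ltP `|f x - g0 x| eta; last by right.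
  by move: fg; rewrite ltr_norml => /andP[fg1 fg2]; rewrite min_r ?max_r; [left|lra|lra].
have muA : (mu (A : set (borel X)) <= (eps / 2)%:E)%E.
  have tau_le : tau mu (fun x => `|f x - g0 x| ^+ 2) <= e ^+ 2.
    have tau0 : 0 <= tau mu (fun x => `|f x - g0 x| ^+ 2).
      apply: (pf_ge0 (tau_positive_functional cX mu)).
        exact: continuous_norm_sqr.
      by move=> x; exact: sqr_ge0.
    rewrite -(sqr_sqrtr tau0) ler_pXn2r ?nnegrE ?sqrtr_ge0 ?(ltW e0)//.
    rewrite -lee_fin; apply: le_trans (ltW fg0).
    by apply: ereal_sup_ubound; exists mu.
  have eta2 : 0 < eta ^+ 2 by rewrite exprn_gt0.
  rewrite -(@lee_pmul2l _ (eta ^+ 2)%:E)//.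
  apply: (@le_trans _ _ (tau mu (fun x => `|f x - g0 x| ^+ 2))%:E).
    apply: mul_measure_le_tau => //; first exact: continuous_norm_sqr.
      exact: ltW.
    by move=> x Ax; rewrite ler_pXn2r ?nnegrE// ltW.
  rewrite -EFinM lee_fin (le_trans tau_le)// /e exprMn ler_pM ?sqr_ge0//.
    by rewrite ler_pXn2r ?nnegrE ?(ltW m0) ?(ltW eta0)// ge_min lexx orbT.
  apply: (@le_trans _ _ q); last by rewrite /q ge_min lexx orbT.
  by rewrite expr2 ger_pMr// /q ge_min lexx.
apply: (@le_lt_trans _ _ (mu (g0 @^-1` [set 0%R] `|` A : set (borel X)))).
  apply: le_measure; rewrite ?in_setE//; first exact: mZ.
  by apply: measurableU => //; exact: mZ.
apply: le_lt_trans (measureU2 mu (mZ _ cg0) mA) _.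
rewrite (splitr eps) EFinD; apply: lte_leD => //.
  by apply: fin_num_measure.
apply: lt_le_trans (zg0 mu Dmu) _; rewrite lee_fin /e.
apply: (@le_trans _ _ q); last by rewrite /q ge_min lexx orbT.
by rewrite ger_pMl// ge_min lexx.
Qed.

End density.

(** * Approximation by functions with null zero set *)

(** The intervals of centre [u n x] and radius [r n] are nested, so the supremum of their left
    endpoints lies in all of them. As the radii tend to 0, the convergence is uniform and the limit
    continuous. *)
Lemma nested_approximation_limit (R : realType) (T : topologicalType)
    (u : nat -> T -> R) (r : nat -> R) :
  (forall n, continuous (u n)) -> (forall n, 0 < r n) ->
  (forall n, r n.+1 <= r n / 2) ->
  (forall n x, `|u n x - u n.+1 x| <= r n / 2) ->
  exists g : T -> R, continuous g /\ forall n x, `|g x - u n x| <= r n.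
Proof.
move=> cu r0 rS uS.
have inc x : {homo (fun n => u n x - r n) : m n / (m <= n)%N >-> m <= n}.
  apply: homo_leq => [//||n]; first exact: le_trans.
  by have := uS n x; have := rS n; rewrite ler_norml => ? /andP[]; lra.
have dec x : {homo (fun n => u n x + r n) : m n / (m <= n)%N >-> n <= m}.
  apply: homo_leq => [//|a b c ab bc|n]; first exact: le_trans ab.
  by have := uS n x; have := rS n; rewrite ler_norml => ? /andP[]; lra.
pose g x := sup (range (fun n => u n x - r n)).
have ubd n x : ubound (range (fun m => u m x - r m)) (u n x + r n).
  move=> _ [m _ <-]; have := inc x _ _ (leq_maxl m n).
  have := dec x _ _ (leq_maxr m n); have := r0 (maxn m n); lra.
have gu n x : `|g x - u n x| <= r n.
  rewrite ler_distl; apply/andP; split.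
    by apply: ub_le_sup; [exists (u 0%N x + r 0%N); exact: ubd|exists n].
  apply: ge_sup; first by exists (u 0%N x - r 0%N); exists 0%N.
  exact: ubd.
(* Halving gives geometric decay, but this harmonic bound suffices; it propagates because
   [n + 2 <= 2 * (n + 1)]. *)
have r_small n : r n <= r 0%N / n.+1%:R.
  elim: n => [|n IH]; first by rewrite divr1.
  apply: le_trans (rS n) _; rewrite ler_pdivrMr// (le_trans IH)//.
  rewrite -mulrA ler_wpM2l ?(ltW (r0 _))// -[leLHS]div1r ler_pdivrMr//.
  rewrite -mulrA ler_pdivlMl// mulr1.
  by rewrite -natrM ler_nat mul2n -addnn addSnnS leq_addl.
exists g; split => // x; apply/cvgrPdist_lt => e e0.
pose n := Num.truncn (r 0%N / (e / 3)).
have rn : r n < e / 3.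
  apply: le_lt_trans (r_small n) _.
  rewrite ltr_pdivrMr// mulrC -ltr_pdivrMr ?divr_gt0//.
  exact: truncnS_gt.
have /cvgrPdist_lt/(_ (e / 3)) := cu n x.
rewrite divr_gt0// => /(_ isT); apply: filterS => y uxy.
have := gu n x; have := gu n y; move: uxy rn.
rewrite !ler_norml !ltr_norml => /andP[? ?] ? /andP[? ?] /andP[? ?].
by apply/andP; split; lra.
Qed.

Section dense_small_boundary.
Context {R : realType} {X : pseudoPMetricType R}.
Hypothesis cX : compact [set: X].
Variable Delta : set (BorelProb R X).
Hypothesis hD : weak_star_closed Delta.
Implicit Types f g h : X -> R.

Hypothesis dense : forall f, continuous f -> forall eps : R, 0 < eps ->
  exists g, [/\ continuous g,
    (norm2Delta Delta (fun x => (f x - g x)%R) < eps%:E)%E &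
    forall mu, Delta mu -> (mu (g @^-1` [set 0%R] : set (borel X)) < eps%:E)%E].

(* The set of functions with uniformly small zero sets is open for the
   uniform norm because the bound on [chi delta \o g] is stable. *)
Lemma dense_step f (eta eps : R) : continuous f -> 0 < eta -> 0 < eps ->
  exists g (r : R), [/\ continuous g, 0 < r, r <= eta / 2,
    forall x, `|f x - g x| <= eta / 2 &
    forall h, continuous h -> (forall x, `|h x - g x| <= r) ->
      forall mu, Delta mu ->
        (mu (h @^-1` [set 0%R] : set (borel X)) <= eps%:E)%E].
Proof.
move=> cf eta0 eps0; have eta20 : 0 < eta / 2 by rewrite divr_gt0.
have [g [cg fg /(measure_zero_set_uniform cX hD cg eps0)[d d0 hd]]] :=
  dense_uniform cX dense cf eta20 eps0.
exists g, (Num.min (eta / 2) (d / 4)); split => //.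
- by rewrite lt_min eta20 divr_gt0.
- by rewrite ge_min lexx.
move=> h ch hg mu Dmu; apply: (@le_trans _ _ (tau mu (chi d \o g))%:E); last first.
  by rewrite lee_fin ltW// hd.
rewrite -[leLHS]mul1e; apply: mul_measure_le_tau => //.
- by move=> x; apply: continuous_comp; [exact: cg|exact: chi_continuous].
- by move=> x; exact: chi_ge0.
- by apply: closed_borel; exact: closed_zero_set.
- move=> x /= hx; rewrite chi_eq1//; have := hg x.
  by rewrite hx sub0r normrN le_min => /andP[_ /le_lt_trans]; apply; lra.
Qed.

(** Iterate [dense_step] with tolerances [1 / (n + 1)]. The limit stays in every ball of the
    sequence, so each of the bounds applies to its zero set. *)
Lemma dense_null_zero_set f (eta : R) : continuous f -> 0 < eta ->
  exists g, [/\ continuous g, forall x, `|f x - g x| <= eta &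
    forall mu, Delta mu -> mu (g @^-1` [set 0%R] : set (borel X)) = 0%E].
Proof.
move=> cf eta0; pose good (p : (X -> R) * R) := continuous p.1 /\ 0 < p.2.
(* The guarantee is conditional on [good], so that [F] is defined on all pairs and the recursion
   carries no proofs. *)
have /choice[F FP] : forall np : nat * ((X -> R) * R),
    exists q : (X -> R) * R, good np.2 ->
    [/\ good q, q.2 <= np.2.2 / 2,
      forall x, `|np.2.1 x - q.1 x| <= np.2.2 / 2 &
      forall h, continuous h -> (forall x, `|h x - q.1 x| <= q.2) ->
      forall mu, Delta mu ->
        (mu (h @^-1` [set 0%R] : set (borel X)) <= (np.1.+1%:R^-1)%:E)%E].
  move=> [n p]; have [[cp p0]|np] := pselect (good p); last by exists p.
  have n0 : 0 < n.+1%:R^-1 :> R by rewrite invr_gt0.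
  by have [g [r [? ? ? ? ?]]] := dense_step cp p0 n0; exists (g, r).
pose u := fix u n := if n is m.+1 then F (m, u m) else (f, eta).
have gu n : good (u n).
  by elim: n => [|n /(FP (n, _))[]//]; split.
have [g [cg gP]] := @nested_approximation_limit R X (fun n => (u n).1)
  (fun n => (u n).2) (fun n => (gu n).1) (fun n => (gu n).2)
  (fun n => let: And4 _ h _ _ := FP (n, u n) (gu n) in h)
  (fun n => let: And4 _ _ h _ := FP (n, u n) (gu n) in h).
exists g; split => //; first by move=> x; rewrite distrC; exact: (gP 0%N x).
move=> mu Dmu; apply/eqP; rewrite eq_le measure_ge0 andbT.
apply/lee_addgt0Pr => e e0; rewrite add0e.
pose n := Num.truncn e^-1.
have [_ _ _ zn] := FP (n, u n) (gu n).
(* The bound [1 / (n + 1)] is attached to the ball produced from stage [n], hence [gP] at [n.+1]. *)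
apply: le_trans (zn g cg (gP n.+1) mu Dmu) _.
rewrite lee_fin -[leRHS]invrK lef_pV2 ?posrE ?invr_gt0//.
by rewrite ltW// truncnS_gt.
Qed.

Lemma dense_SBP : SBP Delta.
Proof.
move=> x U oU Ux; have [p [cp p0 pU pU']] := exists_cutoff oU.
(* Normalised so that [f x = 1] and [f = -1] off [U]; an error of [1 / 2] then preserves both
   signs. *)
pose f y := 2 / p x * p y - 1.
have cf : continuous f.
  apply: continuous_fun_sub; last exact: continuous_fun_cst.
  by apply: continuous_fun_mul => //; exact: continuous_fun_cst.
have half0 : 0 < 1 / 2 :> R by rewrite divr_gt0.
have [g [cg fg zg]] := dense_null_zero_set cf half0.
have oV : open [set y | 0 < g y] by exact: open_gt_fun.
exists [set y | 0 < g y]; split => //=.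
- have := fg x; rewrite /f divfK ?gt_eqF ?pU// ler_norml => /andP[]; lra.
- move=> y /= gy; apply: contrapT => /pU' py.
  by have := fg y; rewrite /f py mulr0 ler_norml => /andP[]; lra.
- move=> mu Dmu; apply/eqP; rewrite eq_le measure_ge0 andbT -(zg mu Dmu).
  apply: le_measure; rewrite ?in_setE//.
  + exact: boundary_borel.
  + by apply: closed_borel; exact: closed_zero_set.
  (* At a boundary point, [g > 0] would put the point in the open set itself, while lying in the
     closure forces [g >= 0]. *)
  + move=> y [cly inty] /=; apply/eqP; rewrite eq_le; apply/andP; split.
      rewrite leNgt; apply/negP => gy; apply: inty.
      by rewrite (interior_id _).1.
    have cge : closed [set y | 0 <= g y] by exact: closed_ge_fun.
    have : closure [set z | 0 <= g z] y by apply: closureS cly => z /ltW.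
    by rewrite -((closure_id _).1 cge).
Qed.

End dense_small_boundary.

Theorem theorem2p9 (R : realType) (X : pseudoPMetricType R)
  (hX : hausdorff_space X) (cX : compact [set: X])
  (Delta : set (BorelProb R X)) (hD : weak_star_closed Delta) :
  (SBP Delta <->
    forall f : X -> R, continuous f -> forall eps : R, 0 < eps ->
      exists g : X -> R, [/\ continuous g,
        (norm2Delta Delta (fun x => (f x - g x)%R) < eps%:E)%E &
        forall mu, Delta mu -> (mu (g @^-1` [set 0%R] : set (borel X)) < eps%:E)%E])
  /\
  (forall g : X -> R, continuous g -> forall eps : R, 0 < eps ->
    ((forall mu, Delta mu -> (mu (g @^-1` [set 0%R] : set (borel X)) < eps%:E)%E) <->
     exists2 delta : R, 0 < delta &
       forall mu, Delta mu -> tau mu (chi delta \o g) < eps)).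

Proof.
split; last by move=> g cg eps e0; exact: measure_zero_set_uniform.
split => [sbp f cf eps e0|dense]; last exact: dense_SBP.
have [g [cg fg zg]] := SBP_dense cX sbp cf e0.
by exists g; split => // mu Dmu; rewrite zg// lte_fin.
Qed.
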